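(* For every positive integer $k$, let $H_k$ be the graph obtained from a star $K_{1,2^k}$ with center $c$, whose leaves are labeled bijectively by the binary strings of length $k$, by adding $k$ new vertices $u_1,\dots,u_k$, where $u_i$ is adjacent exactly to the $2^{k-1}$ leaves whose label has $0$ in the $i$-th digit. Then $\textnormal{edim}(H_k)=k$ and $\textnormal{ftedim}(H_k)\ge 2^{k-1}+1$.
   Context: Graphs are finite, simple, undirected. For an edge $e=\{u,v\}$ and vertex $w$, $\textnormal{dist}(e,w)=\min(\textnormal{dist}(w,u),\textnormal{dist}(w,v))$. A set $S=\{v_1,\dots,v_k\}$ of vertices is an edge resolving set of $G$ if the vectors $(\textnormal{dist}(e,v_1),\dots,\textnormal{dist}(e,v_k))$ are pairwise distinct over all edges $e$. $\textnormal{edim}(G)$ is the minimum size of an edge resolving set; $\textnormal{ftedim}(G)$ is the minimum size of a nonempty $S\subseteq V(G)$ such that $S-\{s\}$ is an edge resolving set for every $s\in S$. *)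

(* Defs.v *)
From HB Require Import structures.
From mathcomp Require Import all_boot.

Set Implicit Arguments.
Unset Strict Implicit.
Unset Printing Implicit Defensive.

Record sgraph := SGraph {
  vertex :> finType;
  adj : rel vertex;
  adj_sym : symmetric adj;
  adj_irrefl : irreflexive adj }.

Section EdgeDimension.
Variable G : sgraph.
Implicit Types (x y u v w : G) (e f S : {set G}).

Definition edges : {set {set G}} :=
  [set e : {set G} | [exists u, exists v, adj u v && (e == [set u; v])]].

Definition walk (n : nat) x y : bool :=
  [exists p : n.-tuple G, path (@adj G) x p && (last x p == y)].

(* The least length of a walk from x to y. Distances inside a component are
   smaller than #|G|, so the value #|G|, returned by find when no such length
   exists, plays the role of infinity. *)
Definition dist x y : nat := find (fun n => walk n x y) (iota 0 #|G|).

(* As dist is bounded by #|G|, the initial value #|G| of the minimum is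
   harmless: see edge_distE. *)
Definition edge_dist e w : nat := \big[minn/#|G|]_(u in e) dist w u.

Definition edge_resolving S : bool :=
  [forall e in edges, forall f in edges,
    [forall s in S, edge_dist e s == edge_dist f s] ==> (e == f)].

Definition ft_edge_resolving S : bool :=
  (S != set0) && [forall s in S, edge_resolving (S :\ s)].

(* The vertex set itself satisfies both conditions (the second one if G is not
   empty; see setT_edge_resolving and setT_ft_edge_resolving), so that both
   minima are attained and the default value setT is never a junk value. *)
Definition edim : nat := #|[arg min_(S < setT | edge_resolving S) #|S|]|.

Definition ftedim : nat := #|[arg min_(S < setT | ft_edge_resolving S) #|S|]|.

Lemma dist_le x y : dist x y <= #|G|.
Proof. by rewrite -[X in _ <= X](size_iota 0) find_size. Qed.

Lemma dist_connect x y : (dist x y < #|G|) = connect (@adj G) x y.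
Proof.
rewrite -[X in _ < X](size_iota 0) -has_find; apply/hasP/idP => [[n _]|].
  by case/existsP=> p /andP[pp /eqP<-]; apply/connectP; exists p.
case/connectP=> p pp ->; case/shortenP: pp => q pq uq _.
exists (size q).
  rewrite mem_iota add0n /=; apply: leq_trans (max_card (mem (x :: q))).
  by rewrite (card_uniqP uq).
by apply/existsP; exists (in_tuple q); rewrite pq eqxx.
Qed.

Lemma dist_eq0 x y : (dist x y == 0) = (x == y).
Proof.
rewrite /dist; have : 0 < #|G| by apply/card_gt0P; exists x.
case: #|G| => // n _ /=; case: ifP => [/existsP[p]|nw].
  by rewrite (tuple0 p) /= => ->.
apply/esym/negbTE/negP=> exy; move/existsP: nw; apply.
by exists [tuple]; rewrite /= exy.
Qed.

Lemma edge_distE u v w :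
  edge_dist [set u; v] w = minn (dist w u) (dist w v).
Proof.
have le x : x \in [set u; v] -> edge_dist [set u; v] w <= dist w x.
  move=> xuv; rewrite /edge_dist; have := mem_index_enum x.
  elim: (index_enum G) => // y r IHr; rewrite inE big_cons.
  case/predU1P=> [<-|/IHr ler]; first by rewrite xuv geq_minl.
  by case: ifP => // _; rewrite geq_min ler orbT.
apply/eqP; rewrite eqn_leq leq_min !le ?set21 ?set22 //=; rewrite /edge_dist.
apply: (big_rec (leq (minn _ _))) => [|x n]; first by rewrite geq_min dist_le.
move=> xuv len; rewrite leq_min len andbT.
by case/set2P: xuv => ->; rewrite ?geq_minl ?geq_minr.
Qed.

Lemma edge_dist_eq0 e w : e \in edges -> (edge_dist e w == 0) = (w \in e).
Proof.
rewrite inE => /existsP[u /existsP[v /andP[_ /eqP->]]].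
rewrite edge_distE -leqn0 geq_min !leqn0 !dist_eq0.
by rewrite !inE.
Qed.

Lemma edge_card2 e : e \in edges -> #|e| = 2.
Proof.
rewrite inE => /existsP[u /existsP[v /andP[uv /eqP->]]].
by rewrite cards2; case: eqP uv => // ->; rewrite adj_irrefl.
Qed.

Lemma setTD1_edge_resolving s : edge_resolving (setT :\ s).
Proof.
apply/forall_inP=> e eE; apply/forall_inP=> f fE.
apply/implyP=> /forall_inP efs.
have mem x : x != s -> (x \in e) = (x \in f).
  move=> xs; rewrite -!edge_dist_eq0 //.
  by have/eqP-> : edge_dist e x == edge_dist f x by rewrite efs // !inE xs.
have eqD : e :\ s = f :\ s.
  by apply/setP=> x; rewrite !inE; case: eqP => //= /eqP/mem.
have := cardsD1 s e; rewrite eqD edge_card2 // -(edge_card2 fE) (cardsD1 s f).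
move/eqP; rewrite eqn_add2r => /eqP sef.
apply/eqP/setP=> x; have [->|/mem //] := eqVneq x s.
by move: sef; do 2!case: (s \in _).
Qed.

Lemma setT_edge_resolving : edge_resolving setT.
Proof.
apply/forall_inP=> e eE; apply/forall_inP=> f fE.
apply/implyP=> /forall_inP efs; apply/eqP/setP=> x.
have/eqP exf : edge_dist e x == edge_dist f x by rewrite efs ?inE.
by rewrite -!edge_dist_eq0 // exf.
Qed.

Lemma setT_ft_edge_resolving : 0 < #|G| -> ft_edge_resolving setT.
Proof.
move=> G0; rewrite /ft_edge_resolving -card_gt0 cardsT G0.
by apply/forall_inP=> s _; apply: setTD1_edge_resolving.
Qed.

End EdgeDimension.

Section StarGraph.
Variable k : nat.

(* The leaves are the binary strings themselves, with digit 0 encoded by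
   false. *)
Inductive hvertex := Center | Leaf of k.-tuple bool | Extra of 'I_k.

Definition hvertex_code (x : hvertex) : option (k.-tuple bool + 'I_k) :=
  match x with
  | Center => None
  | Leaf l => Some (inl l)
  | Extra i => Some (inr i)
  end.

Definition hvertex_decode (c : option (k.-tuple bool + 'I_k)) : hvertex :=
  match c with
  | None => Center
  | Some (inl l) => Leaf l
  | Some (inr i) => Extra i
  end.

Lemma hvertex_codeK : cancel hvertex_code hvertex_decode.
Proof. by case. Qed.

HB.instance Definition _ := Finite.copy hvertex (can_type hvertex_codeK).

Definition hadj (x y : hvertex) : bool :=
  match x, y with
  | Center, Leaf _ | Leaf _, Center => true
  | Extra i, Leaf l | Leaf l, Extra i => tnth l i == false
  | _, _ => false
  end.

Lemma hadj_sym : symmetric hadj.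
Proof. by case=> [|l|i] [|l'|i']. Qed.

Lemma hadj_irrefl : irreflexive hadj.
Proof. by case. Qed.

Definition Hgraph : sgraph := SGraph hadj_sym hadj_irrefl.

End StarGraph.

(* Main.v *)
Require Import Defs.
From mathcomp Require Import all_boot.

(** The vertices u_i resolve all edges: the distance from u_i to an edge at the
    leaf l reads off the i-th digit of l, except that it is 0 when u_i lies on
    the edge. Conversely, a vertex s takes at most two distances to the edges at
    the center c, namely dist(s, c) and dist(s, c) - 1, so an edge resolving set
    S satisfies 2^k <= 2^#|S|. Finally, the edges from c to two leaves that
    differ in the first digit only are separated by nothing but u_1 and these
    two leaves, so an edge resolving set avoiding u_1 meets each of the 2^(k-1)
    pairs of such leaves; fault tolerance costs one more vertex. *)

Set Implicit Arguments.
Unset Strict Implicit.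
Unset Printing Implicit Defensive.

(** * Sets, distances and resolving sets in general *)

Lemma eq_setId (T : finType) (S : {set T}) (P Q : pred T) :
  [set s in S | P s] = [set s in S | Q s] -> {in S, P =1 Q}.
Proof. by move=> /setP eqPQ s sS; have := eqPQ s; rewrite !inE sS. Qed.

(** Repeated descent by the third hypothesis builds a walk from x to y of length [f y]; the second
    makes [f] grow by at most 1 per step, so no walk is shorter. Distances can thus be certified by
    local checks only. *)
Lemma dist_unique (G : sgraph) (x : G) (f : G -> nat) :
    (forall y, (f y == 0) = (y == x)) ->
    (forall y z, adj y z -> f z <= (f y).+1) ->
    (forall y n, f y = n.+1 -> exists2 z, adj z y & f z = n) ->
  forall y, dist x y = f y.
Proof.
move=> f0 lip pred y.
have walk_f n z : f z = n -> walk n x z.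
  elim: n z => [z /eqP|n IHn z /pred[w wz /IHn/existsP[p /andP[pp /eqP lp]]]].
    by rewrite f0 => /eqP->; apply/existsP; exists [tuple] => /=.
  apply/existsP; exists [tuple of rcons p z].
  by rewrite rcons_path last_rcons pp lp wz /=.
have f_walk n z : walk n x z -> f z <= n.
  case/existsP=> p /andP[pp /eqP <-]; rewrite -[n in _ <= n](size_tuple p).
  elim/last_ind: (tval p) pp => [|q w IHq]; first by rewrite leqn0 f0 /=.
  rewrite rcons_path last_rcons size_rcons => /andP[/IHq le_q /lip].
  by move/leq_trans; apply; rewrite ltnS.
have /existsP[p /andP[pp lp]] := walk_f _ _ (erefl (f y)).
(* Being below #|G|, the result of [find] is the length of an actual walk and not the default
   value. *)
have lt_d : dist x y < #|G|.
  by rewrite dist_connect; apply/connectP; exists p => //; rewrite (eqP lp).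
have walk_d : walk (dist x y) x y.
  have:= lt_d; rewrite -[X in _ < X](size_iota 0) -has_find.
  by move/(nth_find 0); rewrite nth_iota.
apply/eqP; rewrite eqn_leq (f_walk _ _ walk_d) andbT leqNgt.
apply/negP=> lt_f; have:= before_find 0 lt_f.
by rewrite nth_iota ?add0n ?(ltn_trans lt_f) // walk_f.
Qed.

Section EdgeDimension.
Variable G : sgraph.
Implicit Types (e f S : {set G}).

Lemma adj_edges (u v : G) : adj u v -> [set u; v] \in edges G.
Proof.
by move=> uv; rewrite inE; apply/existsP; exists u; apply/existsP; exists v;
   rewrite uv /=.
Qed.

Lemma edge_resolvingP S :
  reflect {in edges G &, forall e f,
             {in S, forall s, edge_dist e s = edge_dist f s} -> e = f}
          (edge_resolving S).
Proof.
apply: (iffP forall_inP) => [rS e f eE fE efS | rS e eE].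
  have /forall_inP/(_ f fE)/implyP := rS e eE.
  by move=> ef; apply/eqP/ef/forall_inP=> s /efS->.
apply/forall_inP=> f fE; apply/implyP=> /forall_inP efS.
by apply/eqP/rS => // s /efS/eqP.
Qed.

End EdgeDimension.

(** * Distances and edges of H_k *)

Section StarGraph.
Variable k : nat.
Local Notation H := (Hgraph k).
Local Notation center := (@Center k : H).
Local Notation leaf l := (@Leaf k l : H).
Local Notation extra i := (@Extra k i : H).
Implicit Types (l m : k.-tuple bool) (i j : 'I_k) (S : {set H}).

Definition hdist (x y : hvertex k) : nat :=
  match x, y with
  | Center, Center => 0
  | Center, Leaf _ | Leaf _, Center => 1
  | Center, Extra _ | Extra _, Center => 2
  | Leaf l, Leaf m => if l == m then 0 else 2
  | Leaf l, Extra i | Extra i, Leaf l => if tnth l i then 3 else 1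
  | Extra i, Extra j => if i == j then 0 else 2
  end.

(** This leaf is adjacent to the center and to every u_i, so shortest paths between these vertices
    can pass through it. *)
Definition zero_leaf : k.-tuple bool := [tuple of nseq k false].

Lemma tnth_zero_leaf i : tnth zero_leaf i = false.
Proof. by rewrite (tnth_nth false) nth_nseq if_same. Qed.

Lemma hdist_eq0 x y : (hdist x y == 0) = (y == x).
Proof.
case: x y => [|l|i] [|m|j] //=; try by case: ifP.
  have [->|lm] := eqVneq l m; first by rewrite !eqxx.
  by apply/esym/negbTE; apply: contra lm => /eqP[->].
have [->|ij] := eqVneq i j; first by rewrite !eqxx.
by apply/esym/negbTE; apply: contra ij => /eqP[->].
Qed.

Lemma hdist_lip x y z : hadj y z -> hdist x z <= (hdist x y).+1.
Proof.
case: x y z => [|l|i] [|m|j] [|m'|j'] //=; try by case: ifP.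
- by move/eqP; case: eqP => [-> ->|_ _] //; case: ifP.
- by move=> _; case: ifP; case: ifP.
- by move=> _; case: ifP; case: ifP.
- by move/eqP; case: eqP => [-> ->|_ _] //; case: ifP.
Qed.

Lemma hdist_pred x y n : hdist x y = n.+1 -> exists2 z, hadj z y & hdist x z = n.
Proof.
have t0 := tnth_zero_leaf.
case: x y => [|l|i] [|m|j] //=.
- by case=> <-; exists (Center k).
- by case=> <-; exists (Leaf zero_leaf); rewrite /= ?t0.
- by case=> <-; exists (Leaf l); rewrite //= eqxx.
- by case: ifP => // _ [<-]; exists (Center k).
- case: ifP => lj [<-]; last by exists (Leaf l); rewrite /= ?lj ?eqxx.
  (* Digit j of [l] is 1, so [l] is not [zero_leaf], and the two leaves are at distance 2. *)
  exists (Leaf zero_leaf); rewrite /= ?t0 //.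
  by case: eqP lj => // ->; rewrite t0.
- by case=> <-; exists (Leaf zero_leaf); rewrite /= ?t0.
- case: ifP => mi [<-]; first by exists (Center k).
  by exists (Extra i); rewrite /= ?mi ?eqxx.
by case: ifP => // _ [<-]; exists (Leaf zero_leaf); rewrite /= ?t0.
Qed.

Lemma dist_Hgraph (x y : H) : dist x y = hdist x y.
Proof.
move: y; apply: dist_unique => [y|y z|y n]; first exact: hdist_eq0.
  exact: hdist_lip.
exact: hdist_pred.
Qed.

(** Every edge has exactly one leaf as an end; this is its other end. *)
Definition hub (o : option 'I_k) : H := if o is Some i then extra i else center.

Lemma edges_HgraphP (e : {set H}) : e \in edges H ->
  exists o l, e = [set hub o; leaf l] /\ (forall i, o = Some i -> ~~ tnth l i).
Proof.
rewrite inE => /existsP[[|l|i] /existsP[[|m|j] /andP[//= uv /eqP->]]].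
- by exists None, m.
- by exists None, l; rewrite setUC.
- by exists (Some j), l; rewrite setUC; split=> // _ [<-]; rewrite (eqP uv).
- by exists (Some i), m; split=> // _ [<-]; rewrite (eqP uv).
Qed.

(** Any hub other than u_i is at distance 2 from u_i, which caps the distance 3 to a leaf with i-th
    digit 1. *)
Lemma edge_dist_extra o l i : edge_dist [set hub o; leaf l] (extra i) =
  if o == Some i then 0 else if tnth l i then 2 else 1.
Proof.
rewrite edge_distE !dist_Hgraph; case: o => [j|] /=; last by case: ifP.
by rewrite (eq_sym i) -[Some j == _]/(j == i); case: eqP; case: ifP.
Qed.

(** * The edge dimension of H_k *)

Definition extras : {set H} := [set extra i | i : 'I_k].

Lemma extras_resolving : edge_resolving extras.
Proof.
apply/edge_resolvingP=> e f /edges_HgraphP[o [l [-> ol]]].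
move=> /edges_HgraphP[p [m [-> pm]]] eqS.
have eq_i i : edge_dist [set hub o; leaf l] (extra i)
            = edge_dist [set hub p; leaf m] (extra i) by apply/eqS/imset_f.
have op i : (o == Some i) = (p == Some i).
  by have := eq_i i; rewrite !edge_dist_extra; do 2!case: (_ == Some i);
     do 2?case: ifP.
have -> : o = p.
  case: (o) op => [i|] op; first by apply/esym/eqP; rewrite -op.
  by case: (p) op => // j /(_ j); rewrite eqxx.
suff -> : l = m by [].
apply: eq_from_tnth => i; have := eq_i i; rewrite !edge_dist_extra -op.
(* If u_i is the common hub, its distance 0 says nothing about the digit, but both leaves are
   adjacent to u_i and so have i-th digit 0. *)
have [oi|_] := eqVneq o (Some i); last by do 2!case: (tnth _ i).
have /eqP pi : p == Some i by rewrite -op oi.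
by rewrite (negbTE (ol _ oi)) (negbTE (pm _ pi)).
Qed.

Lemma card_extras : #|extras| = k.
Proof. by rewrite card_imset ?card_ord // => i j []. Qed.

Lemma center_edges l : [set center; leaf l] \in edges H.
Proof. exact: adj_edges. Qed.

Lemma center_edge_inj l m :
  [set center; leaf l] = [set center; leaf m] -> l = m.
Proof.
by move/setP/(_ (leaf l)); rewrite !inE eqxx /= => /esym/eqP[].
Qed.

Lemma edge_resolving_card S : edge_resolving S -> k <= #|S|.
Proof.
move=> /edge_resolvingP rS.
(* The edge from c to [l] is at distance dist(s, c) - 1 from s if s is in [near l], and dist(s, c)
   otherwise, so [near l] determines all its distances from S. *)
pose near l := [set s in S | dist s (leaf l) < dist s center].
have near_inj : injective near.
  move=> l m eq_near; apply/center_edge_inj/rS=> [||s sS].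
  - exact: center_edges.
  - exact: center_edges.
  have := eq_setId eq_near sS; rewrite !edge_distE !dist_Hgraph.
  clear; case: s => [|l'|i] /=; first by [].
    by do 2!case: eqP.
  by do 2!case: (tnth _ i).
rewrite -(leq_exp2l _ _ (ltnSn 1)) -card_powerset -{1}card_bool -card_tuple.
rewrite -(card_imset _ near_inj); apply/subset_leq_card/subsetP=> _ /imsetP[l _ ->].
by rewrite inE; apply/subsetP=> s; rewrite inE => /andP[].
Qed.

Lemma edim_Hgraph : edim H = k.
Proof.
rewrite /edim; case: arg_minnP => [|S rS minS].
  exact: setT_edge_resolving.
apply/eqP; rewrite eqn_leq edge_resolving_card // andbT.
by apply: leq_trans (minS _ extras_resolving) _; rewrite card_extras.
Qed.

(** * The lower bound under fault tolerance *)

Lemma leaf_pair S i l m : edge_resolving S -> extra i \notin S ->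
    (forall j, j != i -> tnth l j = tnth m j) -> l != m ->
  (leaf l \in S) || (leaf m \in S).
Proof.
move=> /edge_resolvingP rS iS lm; apply: contraR; rewrite negb_or => /andP[lS mS].
apply/eqP/center_edge_inj/rS=> [||s sS]; try exact: center_edges.
(* A leaf other than [l] and [m] is at distance 1 from both edges, through the center, and u_j with
   j different from i sees the same digit in [l] and [m]. *)
rewrite !edge_distE !dist_Hgraph; case: s sS => [|l'|j] //= sS.
  have l'P x : leaf x \notin S -> (l' == x) = false.
    by move=> xS; apply: contraNF xS => /eqP <-.
  by rewrite !l'P.
by rewrite lm //; apply: contraNneq iS => <-.
Qed.

End StarGraph.

Lemma edge_resolving_avoid k (S : {set Hgraph k.+1}) :
  edge_resolving S -> (@Extra k.+1 ord0 : Hgraph k.+1) \notin S -> 2 ^ k <= #|S|.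
Proof.
move=> rS iS; pose lf b (t : k.-tuple bool) : Hgraph k.+1 := Leaf [tuple of b :: t].
(* From the pair of leaves with common tail [t], [g] picks one that lies in S; the tail makes [g]
   injective. *)
pose g t := lf (lf true t \in S) t.
have g_inj : injective g by move=> t t' [_ /val_inj].
rewrite -{1}card_bool -card_tuple -(card_imset _ g_inj).
apply/subset_leq_card/subsetP=> _ /imsetP[t _ ->]; rewrite /g.
have [//|tS] := boolP (lf true t \in S).
suff : (lf true t \in S) || (lf false t \in S) by rewrite (negbTE tS).
apply: leaf_pair iS _ _ => // j.
by case: (unliftP ord0 j) => [j' ->|->]; rewrite ?eqxx // !tnthS.
Qed.

Lemma ft_edge_resolving_card k (S : {set Hgraph k.+1}) :
  ft_edge_resolving S -> 2 ^ k < #|S|.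
Proof.
case/andP=> /set0Pn[s sS] /forall_inP ftS; pose u : Hgraph k.+1 := Extra ord0.
(* The vertex to delete is u_1 itself if it lies in S, and any element of S otherwise. *)
have [t tS uS] : exists2 t, t \in S & u \notin S :\ t.
  have [uS|uS] := boolP (u \in S); first by exists u; rewrite // !inE eqxx.
  by exists s; rewrite // !inE negb_and uS orbT.
by rewrite (cardsD1 t) tS add1n ltnS edge_resolving_avoid ?ftS.
Qed.

Theorem theorem12 (k : nat) (hk : 0 < k) :
  edim (Hgraph k) = k /\ 2 ^ (k - 1) + 1 <= ftedim (Hgraph k).
Proof.
split; first exact: edim_Hgraph.
case: k hk => // k _; rewrite subn1 addn1 /ftedim.
case: arg_minnP => [|S ftS _]; last exact: ft_edge_resolving_card.
by apply: setT_ft_edge_resolving; apply/card_gt0P; exists (@Center k.+1).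
Qed.
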